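(* Let $M\geq 1$ be an integer and let $(\tau^\prime,R)$ be an $M$-layer medium for transmission, with $\tau^\prime=(\tau_0,\ldots,\tau_{M+1})$, $\tau=(\tau_0,\ldots,\tau_M)$, $R=(R_0,\ldots,R_M)$, and write $|\tau^\prime|=\tau_0+\cdots+\tau_{M+1}$. Then \[ H^{(\tau^\prime,R)}(t)=\sum_{k\in\{0\}\times\mathbb{Z}^M_+}b(R,k)\,\delta\bigl(t-\tfrac{1}{2}|\tau^\prime|-\langle k,\tau\rangle\bigr), \] where for each $k\in\{0\}\times\mathbb{Z}^M_+$, \[ b(R,k)=\sum_{0\leq m\leq\min\{k,\tilde{k}\}}\binom{k}{m}\binom{\tilde{k}}{m}(-R)^{\tilde{k}-m}R^{k-m}T^{2m+\mathbb{1}}, \] the sum being over $m\in\mathbb{Z}^{M+1}$.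
   Context: Fix depths $z_{-1}<z_0<\cdots<z_M<z_{M+1}$. The medium consists of positive reals $\tau^\prime=(\tau_0,\ldots,\tau_{M+1})$ ($\tau_j/2$ is the time to traverse between $z_{j-1}$ and $z_j$) and reals $R=(R_0,\ldots,R_M)$ with $-1<R_n<1$; $T_n=\sqrt{1-R_n^2}$, $T=(T_0,\ldots,T_M)$. $\mathbb{Z}_+$ denotes the nonnegative integers. A transmission scattering sequence is a finite sequence $\mathsf{p}=(\mathsf{p}_0,\ldots,\mathsf{p}_L)$ with $\mathsf{p}_0=z_{-1}$, $\mathsf{p}_L=z_{M+1}$, $\mathsf{p}_i\in\{z_0,\ldots,z_M\}$ for $1\le i\le L-1$, and for every $0\le i\le L-1$ there is $-1\le j\le M$ with $\{\mathsf{p}_i,\mathsf{p}_{i+1}\}=\{z_j,z_{j+1}\}$. Its weight is $w(\mathsf{p})=\prod_{i=1}^{L-1}w_i$, where if $\mathsf{p}_i=z_j$: $w_i=R_j$ if $\mathsf{p}_{i-1}=\mathsf{p}_{i+1}=z_{j-1}$; $w_i=-R_j$ if $\mathsf{p}_{i-1}=\mathsf{p}_{i+1}=z_{j+1}$; $w_i=T_j$ otherwise. Its arrival time is $\sigma(\mathsf{p})=\sum_{i=0}^{L-1}\tau_{j_i}/2$ where step $i$ goes between $z_{j_i-1}$ and $z_{j_i}$ ($0\le j_i\le M+1$). The transmission Green's function (velocity impulse response recorded at $z_{M+1}$ for a downward unit plane-wave impulse started at $z_{-1}$) is $H^{(\tau^\prime,R)}(t)=\sum_{\mathsf{p}}w(\mathsf{p})\delta(t-\sigma(\mathsf{p}))$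 over all transmission scattering sequences, terms with equal arrival times combined. Vector conventions: $\tilde{k}=(k_1,\ldots,k_M,0)$; $\mathbb{1}=(1,\ldots,1)$; $\min$ and $\le$ entrywise; $\langle k,\tau\rangle=\sum_{n=0}^M k_n\tau_n$; $s^d=\prod_n s_n^{d_n}$ (with $0^0=1$); $\binom{x}{y}=\prod_n\binom{x_n}{y_n}$. *)

(* Defs.v *)
From HB Require Import structures.
From mathcomp Require Import all_boot all_order all_algebra.
From mathcomp Require Import reals.
Set Implicit Arguments. Unset Strict Implicit. Unset Printing Implicit Defensive.
Import Order.TTheory GRing.Theory Num.Theory.
Local Open Scope ring_scope.

(* Encoding: a depth z_j (-1 <= j <= M+1) is encoded by the value j+1 : 'I_(M+3).
   A sequence p = (p_0,...,p_L) is a finite function 'I_(L+1) -> 'I_(M+3).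
   The medium: tau j = tau_j (0 <= j <= M+1), r n = R_n (0 <= n <= M);
   values of tau, r outside these ranges are irrelevant. *)

Section Defs.
Variable (R : realType) (M : nat) (tau r : nat -> R).

Definition Tc (n : nat) : R := Num.sqrt (1 - r n ^+ 2).

Definition pos (L : nat) (p : {ffun 'I_L.+1 -> 'I_M.+3}) (i : nat) : nat :=
  p (inord i).

Definition is_tss (L : nat) (p : {ffun 'I_L.+1 -> 'I_M.+3}) : bool :=
  [&& pos p 0 == 0%N, pos p L == M.+2,
      [forall i : 'I_L.+1, ((0 < i) && (i < L))%N ==> (0 < pos p i <= M.+1)%N]
    & [forall i : 'I_L, ((pos p i).+1 == pos p i.+1) || ((pos p i.+1).+1 == pos p i)]].

(* weight w(p); at interior index i, p_i = z_j with j = pos p i - 1 *)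
Definition weight (L : nat) (p : {ffun 'I_L.+1 -> 'I_M.+3}) : R :=
  \prod_(i < L.+1 | ((0 < i) && (i < L))%N)
    (let v := pos p i in let j := v.-1 in
     if (pos p i.-1 == v.-1) && (pos p i.+1 == v.-1) then r j
     else if (pos p i.-1 == v.+1) && (pos p i.+1 == v.+1) then - r j
     else Tc j).

(* arrival time sigma(p): the step between z_(v-1) and z_v costs tau_v / 2 *)
Definition arrival (L : nat) (p : {ffun 'I_L.+1 -> 'I_M.+3}) : R :=
  \sum_(i < L) tau (minn (pos p i) (pos p i.+1)) / 2.

(* coefficient of delta(t - .) in H^(tau',R), restricted to sequences with
   fewer than N steps (for N large enough w.r.t. t this is the full coefficient) *)
Definition Hcoef (N : nat) (t : R) : R :=
  \sum_(L < N) \sum_(p : {ffun 'I_L.+1 -> 'I_M.+3} | is_tss p && (arrival p == t))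
     weight p.

(* k in {0} x Z_+^M from kk : 'I_M -> nat : k_0 = 0, k_n = kk (n-1) *)
Definition kvec (N : nat) (kk : {ffun 'I_M -> 'I_N}) (n : nat) : nat :=
  if n is n'.+1 then (if (insub n' : option 'I_M) is Some i then nat_of_ord (kk i) else 0%N)
  else 0%N.

Definition ktilde (k : nat -> nat) (n : nat) : nat :=
  if (n < M)%N then k n.+1 else 0%N.

Definition bcoef (k : nat -> nat) : R :=
  let kt := ktilde k in
  let S := (\sum_(n < M.+1) k n)%N in
  \sum_(m : {ffun 'I_M.+1 -> 'I_S.+1} | [forall n, (m n <= minn (k n) (kt n))%N])
    \prod_(n < M.+1)
      (('C(k n, m n) * 'C(kt n, m n))%:R * (- r n) ^+ (kt n - m n)
        * r n ^+ (k n - m n) * Tc n ^+ (2 * m n + 1)).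

Definition tau_abs : R := \sum_(j < M.+2) tau j.

Definition kdot (k : nat -> nat) : R := \sum_(n < M.+1) (k n)%:R * tau n.

(* coefficient of delta(t - .) on the right-hand side, restricted to k_n < N *)
Definition RHScoef (N : nat) (t : R) : R :=
  \sum_(kk : {ffun 'I_M -> 'I_N} | tau_abs / 2 + kdot (kvec kk) == t)
     bcoef (kvec kk).

End Defs.

(* Main.v *)
(* On a line of interfaces, the direction in which a sequence leaves an interface
   is also the direction from which it next returns there, and before the first
   visit the sequence is above the interface. So the factors collected at an
   interface depend only on its own word of exit directions, and prescribing the
   numbers k_n of upward crossings of the layers fixes the letter counts of all
   these words; each word ends with a downward exit. Summing over the words of
   each interface independently gives a product of local sums, in which m counts
   the upward transmissions. The words are assembled into a sequence one step at a
   time: the total weight of the continuations of a partial sequence and the product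
   of the local sums satisfy the same recursion on the number of steps left. *)
Require Import Defs.
From HB Require Import structures.
From mathcomp Require Import all_boot all_order all_algebra.
From mathcomp Require Import reals ring zify.
Import Order.TTheory GRing.Theory Num.Theory.
Local Open Scope ring_scope.
Set Implicit Arguments. Unset Strict Implicit. Unset Printing Implicit Defensive.

Lemma big_ord_trunc (V : nmodType) (m n : nat) (F : nat -> V) :
  (m <= n)%N -> (forall i, (m <= i)%N -> F i = 0) ->
  \sum_(i < n) F i = \sum_(i < m) F i.
Proof.
move=> le_mn F0; rewrite -!(big_mkord xpredT) [LHS](big_cat_nat (leq0n m) le_mn) /=.
by rewrite [X in _ + X]big_nat_cond [X in _ + X]big1 ?addr0 // => i /andP[/andP[/F0]].
Qed.

(** * Local sums at one interface *)

Section Local.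
Variables (R : comPzRingType) (x y : R).

(* Compositions of [a] into [m] positive parts. *)
Definition composition_count (a m : nat) : nat :=
  match a, m with
  | 0, 0 => 1
  | a'.+1, m'.+1 => 'C(a', m')
  | _, _ => 0
  end.

(* [exits e a b] is the total weight of the words of [a] upward and [b] downward exits
   that end with a downward exit, when the previous exit was upward ([e = true]) or
   downward ([e = false]); [m] counts the transmissions from below to above. The word
   is cut into maximal runs; [composition_count] differs from a binomial because a
   first upward run is nonempty when it follows a downward exit. *)
Definition exitsU (a b : nat) : R :=
  \sum_(m < b) ('C(a, m) * 'C(b.-1, m))%:R * (- x) ^+ (b.-1 - m)
     * x ^+ (a - m) * y ^+ (2 * m + 1).

Definition exitsD (a b : nat) : R :=
  \sum_(m < b.+1) (composition_count a m * 'C(b, m))%:R * (- x) ^+ (b - m)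
     * x ^+ (a - m) * y ^+ (2 * m).

Definition exits (e : bool) := if e then exitsU else exitsD.

(** [e] is the side of arrival ([true]: above) and [e'] the exit ([true]: upward). With [x] = R_j
    and [y] = T_j this is the factor w_i. *)
Definition turn (e e' : bool) : R :=
  if e then (if e' then x else y) else (if e' then y else - x).

Lemma exitsU0 b : exitsU 0 b.+1 = y * exitsD 0 b.
Proof.
rewrite /exitsU /exitsD !big_ord_recl !big1 /= => [|i _|i _].
- by rewrite !addr0 !bin0 subnn; ring.
- by rewrite mul0n !mul0r.
- by rewrite mul0n !mul0r.
Qed.

Lemma exitsD0 b : exitsD 0 b.+1 = - x * exitsD 0 b.
Proof.
rewrite /exitsD !big_ord_recl !big1 /= => [|i _|i _].
- by rewrite !addr0 !bin0 subnn !subn0 exprS; ring.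
- by rewrite mul0n !mul0r.
- by rewrite mul0n !mul0r.
Qed.

Lemma exitsUS a b : exitsU a.+1 b.+1 = x * exitsU a b.+1 + y * exitsD a.+1 b.
Proof.
rewrite /exitsU /exitsD /= !big_distrr /= -big_split /=; apply: eq_bigr => -[m _] _ /=.
case: m => [|m] /=; first by rewrite !bin0 !subn0 exprS mul0n; ring.
(* Pascal's rule, in [a] here and in [b] in the next lemma, matches the two possible first exits
   term by term. *)
rewrite binS subSS mulnDl natrD.
(* For [a <= m] an exponent of [x] is truncated, but its binomial coefficient vanishes. *)
have [lt_ma|le_am] := ltnP m a.
  by rewrite -(subnSK lt_ma) exprS !mulnS !add2n !addn1 !exprS; ring.
by rewrite (bin_small (n := a) (m := m.+1)) // mul0n !mulnS !add2n !addn1 !exprS; ring.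
Qed.

Lemma exitsDS a b : exitsD a.+1 b.+1 = y * exitsU a b.+1 + - x * exitsD a.+1 b.
Proof.
rewrite /exitsU /exitsD /= big_ord_recl /= mul0n !mul0r add0r.
(* Shift of [m] by one: the term at 0 vanishes, and a vanishing term at the top restores the
   range. *)
rewrite (_ : - x * _ = \sum_(m < b.+1) - x * (('C(a, m) * 'C(b, m.+1))%:R *
     (- x) ^+ (b - m.+1) * x ^+ (a - m) * y ^+ (2 * m.+1))); last first.
  rewrite big_ord_recl big_ord_recr /= mul0n !mul0r add0r (bin_small (ltnSn b)) muln0 !mul0r mulr0 addr0.
  by rewrite big_distrr; apply: eq_bigr => i _ /=; rewrite subSS.
rewrite big_distrr -big_split /=; apply: eq_bigr => -[m /= _] _.
rewrite /bump /= add1n binS !subSS mulnDr natrD.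
have [lt_mb|le_bm] := ltnP m b.
  by rewrite -(subnSK lt_mb) exprS !mulnS !add2n !addn1 !exprS; ring.
by rewrite (bin_small (n := b) (m := m.+1)) // muln0 !mulnS !add2n !addn1 !exprS; ring.
Qed.

Lemma exits_rec e a b : exits e a b.+1 =
  (if (0 < a)%N then turn e true * exits true a.-1 b.+1 else 0)
  + turn e false * exits false a b.
Proof.
by case: a => [|a]; case: e; rewrite /= ?add0r ?exitsU0 ?exitsD0 ?exitsUS ?exitsDS.
Qed.

(** Only the empty word has no downward exit; it is complete when the previous exit was downward. *)
Lemma exitsD_eq0 a : exits false a 0 = (a == 0)%:R.
Proof. by rewrite /= /exitsD big_ord1; case: a => [|a]; rewrite /= ?mul0n ?mul0r // bin0 !expr0 !mulr1. Qed.

End Local.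

(** * Upward crossings and travel times *)

Section Crossings.

Definition adjacent (x y : nat) : bool := (x.+1 == y) || (y.+1 == x).

(** Vertex [v] stands for z_(v-1), so a step from [n.+1] to [n] traverses layer [n] upward. *)
Definition upcross (L : nat) (f : nat -> nat) (n : nat) : nat :=
  \sum_(i < L) ((f i == n.+1) && (f i.+1 == n)).

Lemma upcross_le L f n : (upcross L f n <= L)%N.
Proof.
rewrite -[X in (_ <= X)%N]card_ord -sum1_card; apply: leq_sum => i _; exact: leq_b1.
Qed.

Lemma upcrossS L f g n : (forall i, (i <= L)%N -> f i.+1 = g i) ->
  upcross L.+1 f n = ((f 0 == n.+1) && (g 0 == n) + upcross L g n)%N.
Proof.
move=> fg; rewrite /upcross big_ord_recl /= fg //; congr addn.
by apply: eq_bigr => i _; rewrite /bump add1n !fg // ltnW.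
Qed.

(* Telescoping along [phi v = \sum_(n < v) tau n / 2]: a step costs the increase of
   [phi], plus the whole layer time when it goes up. *)
Lemma travel_time (F : numFieldType) (tau : nat -> F) (K L : nat) (f : nat -> nat) :
  (forall i, (i < L)%N -> adjacent (f i) (f i.+1)) ->
  (forall i, (i < L)%N -> (f i <= K)%N) ->
  \sum_(i < L) tau (minn (f i) (f i.+1)) / 2 =
  \sum_(n < f L) tau n / 2 - \sum_(n < f 0) tau n / 2
  + \sum_(n < K) (upcross L f n)%:R * tau n.
Proof.
move=> adj fK; pose phi v := \sum_(n < v) tau n / 2.
have step (i : 'I_L) : tau (minn (f i) (f i.+1)) / 2 =
   (phi (f i.+1) - phi (f i)) + \sum_(n < K) ((f i == n.+1) && (f i.+1 == n))%:R * tau n.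
  have := fK i (ltn_ord i); case/orP: (adj i (ltn_ord i)) => /eqP <- le_K.
    rewrite (minn_idPl _) // /phi big_ord_recr /= [\sum_(n < K) _]big1 => [|n _]; first by ring.
    by rewrite (_ : _ && _ = false) ?mul0r //; apply/negP => /andP[/eqP -> /eqP]; lia.
  rewrite (minn_idPr _) // /phi big_ord_recr /= (bigD1 (Ordinal le_K)) //= !eqxx mul1r [X in _ + (_ + X)]big1 => [|n].
    by field.
  by rewrite -val_eqE /= => ne; rewrite [_ && _](contraNF _ ne) ?mul0r // => /andP[_ /eqP ->].
rewrite (eq_bigr _ (fun i _ => step i)) big_split /= exchange_big /=; congr (_ + _).
  by rewrite -(big_mkord xpredT (fun i => phi (f i.+1) - phi (f i))) telescope_sumr.
by apply: eq_bigr => n _; rewrite /upcross natr_sum big_distrl.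
Qed.

End Crossings.

(** * Prepending a vertex to a sequence *)

Definition ffun_cons (A : finType) (L : nat) (a : A) (q : {ffun 'I_L -> A}) :
  {ffun 'I_L.+1 -> A} := [ffun i => oapp q a (unlift ord0 i)].

Lemma big_ffun_cons (V : nmodType) (A : finType) (L : nat)
    (P : pred {ffun 'I_L.+1 -> A}) (F : {ffun 'I_L.+1 -> A} -> V) :
  \sum_(p | P p) F p = \sum_a \sum_(q | P (ffun_cons a q)) F (ffun_cons a q).
Proof.
rewrite pair_big_dep /= (reindex (fun x => ffun_cons x.1 x.2)) //.
exists (fun p : {ffun 'I_L.+1 -> A} => (p ord0, [ffun j : 'I_L => p (lift ord0 j)])) => [[a q]|p] _ /=.
  by congr pair; [rewrite ffunE unlift_none | apply/ffunP => i; rewrite !ffunE liftK].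
by apply/ffunP => i; rewrite ffunE; case: unliftP => [j|] -> //=; rewrite ffunE.
Qed.

Lemma pos_ffun_cons0 M L (a : 'I_M.+3) (q : {ffun 'I_L.+1 -> 'I_M.+3}) :
  pos (ffun_cons a q) 0 = a.
Proof.
by rewrite /pos (_ : inord 0 = ord0) ?ffunE ?unlift_none //; apply/val_inj; rewrite /= inordK.
Qed.

Lemma pos_ffun_consS M L (a : 'I_M.+3) (q : {ffun 'I_L.+1 -> 'I_M.+3}) i :
  (i <= L)%N -> pos (ffun_cons a q) i.+1 = pos q i.
Proof.
move=> le_iL; rewrite /pos (_ : inord i.+1 = lift ord0 (inord i)) ?ffunE ?liftK //.
by apply/val_inj; rewrite /= !inordK.
Qed.

(** * Path sums, products of local sums, and their common recursion *)

Section PathSum.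
Variables (R : realType) (M : nat) (r : nat -> R).

Definition vertex_weight (u v w : nat) : R :=
  let j := v.-1 in
  if (u == v.-1) && (w == v.-1) then r j
  else if (u == v.+1) && (w == v.+1) then - r j
  else Tc r j.

Definition prev (u : nat) (f : nat -> nat) (i : nat) : nat :=
  if i is i'.+1 then f i' else u.

(* The first vertex of a route is already an interface (unless [L = 0]): a
   transmission scattering sequence is a route preceded by the vertex 0. *)
Definition route (L : nat) (f : nat -> nat) (k : nat -> nat) : bool :=
  [&& f L == M.+2,
      [forall i : 'I_L, (0 < f i <= M.+1)%N && adjacent (f i) (f i.+1)]
    & [forall n : 'I_M.+2, upcross L f n == k n]].

(* [u] is the vertex visited just before the route, so that its first vertex has a weight. *)
Definition path_sum (L u v : nat) (k : nat -> nat) : R :=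
  \sum_(p : {ffun 'I_L.+1 -> 'I_M.+3} | (pos p 0 == v) && route L (pos p) k)
    \prod_(i < L) vertex_weight (prev u (pos p) i) (pos p i) (pos p i.+1).

Definition decr (k : nat -> nat) (j n : nat) : nat := (k n - (n == j))%N.

(** A first step down leaves the counts unchanged; a first step up uses one crossing of the layer
    just above. The positivity test rules out truncation in [decr]. *)
Lemma routeS L f g k : (forall i, (i <= L)%N -> f i.+1 = g i) ->
  (0 < f 0 <= M.+1)%N ->
  route L.+1 f k =
   ((g 0 == (f 0).+1) && route L g k) ||
   [&& g 0 == (f 0).-1, (0 < k (f 0).-1)%N & route L g (decr k (f 0).-1)].
Proof.
move=> fg /andP[f0_gt0 f0_le]; rewrite /route (fg L) //; case: (g L == _); rewrite ?andbF //=.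
have ->: [forall i : 'I_L.+1, (0 < f i <= M.+1)%N && adjacent (f i) (f i.+1)] =
   adjacent (f 0) (g 0) && [forall i : 'I_L, (0 < g i <= M.+1)%N && adjacent (g i) (g i.+1)].
  apply/forallP/andP => [H|[H0 /forallP H] [[|i] ltiL]] /=.
  - split; first by have := H ord0; rewrite /= fg // => /andP[].
    apply/forallP => i; have := H (lift ord0 i).
    by rewrite /= /bump add1n !fg // ltnW.
  - by rewrite fg // f0_gt0 f0_le.
  - by have := H (Ordinal (ltiL : (i < L)%N)); rewrite /= !fg // ltnW.
case: [forall i : 'I_L, _]; rewrite ?andbF //= andbT.
have up n := @upcrossS L f g n fg.
rewrite /adjacent eq_sym; case: eqP => [g0 | ne_g0] /=.
  rewrite (_ : (g 0 == (f 0).-1) = false) ?orbF; last by apply/eqP; lia.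
  have no_up n : (f 0 == n.+1) && (g 0 == n) = false.
    by apply/negP => /andP[/eqP ? /eqP ?]; lia.
  by apply: eq_forallb => n; rewrite up no_up.
rewrite (_ : ((g 0).+1 == f 0) = (g 0 == (f 0).-1)); last by rewrite -[in LHS](prednK f0_gt0) eqSS.
case: eqP => //= g0.
have upE n : upcross L.+1 f n = ((n == (f 0).-1) + upcross L g n)%N.
  by rewrite up g0; congr (nat_of_bool _ + _)%N; apply/andP/eqP => [[/eqP -> //]|->]; rewrite prednK.
apply/forallP/andP => [H|[k_gt0 /forallP H] n].
  have lt_f0 : ((f 0).-1 < M.+2)%N by rewrite prednK // ltnW.
  split; first by have := H (Ordinal lt_f0); rewrite upE eqxx => /eqP <-.
  by apply/forallP => n; have := H n; rewrite upE /decr => /eqP <-; rewrite addKn.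
have := H n; rewrite upE /decr => /eqP ->; case: (_ =P (f 0).-1) => [->|_]; last by rewrite subn0.
by rewrite subnKC.
Qed.

Lemma path_sum_end L u k : path_sum L.+1 u M.+2 k = 0.
Proof.
apply: big_pred0 => p; apply/negP => /andP[/eqP p0 /and3P[_ /forallP/(_ ord0)]].
by rewrite p0 /= ltnn.
Qed.

Lemma path_sum0 u v k : (v <= M.+2)%N ->
  path_sum 0 u v k = ((v == M.+2) && (\sum_(n < M.+2) k n == 0)%N)%:R.
Proof.
move=> le_v; rewrite /path_sum.
under eq_bigr do rewrite big_ord0.
have cond (p : {ffun 'I_1 -> 'I_M.+3}) : (pos p 0 == v) && route 0 (pos p) k =
   (pos p 0 == v) && ((v == M.+2) && (\sum_(n < M.+2) k n == 0)%N).
  rewrite /route; case: (pos p 0 =P v) => //= ->; congr andb.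
  rewrite sum_nat_eq0; rewrite (_ : [forall i : 'I_0, _]); last by apply/forallP => -[].
  by apply: eq_forallb => n; rewrite /upcross big_ord0 eq_sym.
rewrite (eq_bigl _ _ cond); case: (_ && (_ == 0)%N); last by rewrite big_pred0 // => p; rewrite andbF.
rewrite (big_pred1 [ffun=> inord v]) // => p; rewrite andbT.
apply/eqP/eqP => [<-|->]; last by rewrite /pos ffunE inordK.
by apply/ffunP => i; rewrite ffunE /pos inord_val (ord1 (inord 0)) (ord1 i).
Qed.

(** The factor at [v] depends only on [u] and the next vertex; [v] then becomes the predecessor of
    the remaining route. *)
Lemma path_sumS L u v k : (0 < v <= M.+1)%N ->
  path_sum L.+1 u v k =
   (if (0 < k v.-1)%N then vertex_weight u v v.-1 * path_sum L v v.-1 (decr k v.-1) else 0)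
   + vertex_weight u v v.+1 * path_sum L v v.+1 k.
Proof.
move=> vP; rewrite /path_sum big_ffun_cons.
have lt_v : (v < M.+3)%N by lia.
rewrite (bigD1 (Ordinal lt_v)) //= [X in _ + X]big1 ?addr0; last first.
  move=> a ne_av; apply: big_pred0 => q; rewrite pos_ffun_cons0.
  by move: ne_av; rewrite -val_eqE /= => /negPf ->.
set c := ffun_cons _; have posS q := @pos_ffun_consS M L (Ordinal lt_v) q.
have pos0 q : pos (c q) 0 = v by rewrite pos_ffun_cons0.
pose G (q : {ffun 'I_L.+1 -> 'I_M.+3}) :=
  \prod_(i < L) vertex_weight (prev v (pos q) i) (pos q i) (pos q i.+1).
rewrite (eq_bigr (fun q => vertex_weight u v (pos q 0) * G q)); last first.
  move=> q _; rewrite big_ord_recl /= pos0 posS //; congr (_ * _).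
  apply: eq_bigr => -[[|i] lt_iL] _; rewrite /= /bump !add1n /=.
    by rewrite pos0 !posS.
  by rewrite !posS ?(ltnW lt_iL) // ltnW // ltnW.
rewrite (eq_bigl (fun q => ((pos q 0 == v.+1) && route L (pos q) k) ||
   [&& pos q 0 == v.-1, (0 < k v.-1)%N & route L (pos q) (decr k v.-1)])); last first.
  by move=> q; rewrite (routeS (g := pos q)) ?pos0 ?eqxx // => i; apply: posS.
rewrite (bigID (fun q => pos q 0 == v.+1)) /= addrC; congr (_ + _).
  case: ifP => k_gt0; last first.
    rewrite big_pred0 // => q; rewrite andbF orbF.
    by case: (_ == _); rewrite /= ?andbF.
  rewrite big_distrr /=; apply: eq_big => [q|q /andP[/orP[/andP[-> //]|/andP[/eqP -> //]]]].
  case: (pos q 0 =P v.+1) => [->|_] /=; last by rewrite andbT.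
  by rewrite andbF; case: eqP => //; lia.
rewrite big_distrr /=; apply: eq_big => [q|q /andP[_ /eqP -> //]].
case: (pos q 0 =P v.+1) => [->|_] /=; last by rewrite andbF.
rewrite andbT; case: (v.+1 =P v.-1) => [|_]; [lia | by rewrite orbF].
Qed.

(* The last exit from [n] of a partial sequence now at [v], where it arrived from above
   iff [e]; an interface not visited yet counts as left upwards. *)
Definition last_exit (v : nat) (e : bool) (n : nat) : bool :=
  if (n < v)%N then false else (n == v) ==> e.

(* Every layer below the current vertex has one more downward than upward crossing to come. *)
Definition state_weight (v : nat) (e : bool) (k : nat -> nat) : R :=
  \prod_(n < M.+1) exits (r n) (Tc r n) (last_exit v e n.+1) (k n) (k n.+1 + (v <= n.+1))%N.

(** Each upward crossing is undone by a downward one, besides the net descent from [v] to [M.+2]. *)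
Definition steps_left (v : nat) (k : nat -> nat) : nat :=
  (2 * \sum_(n < M.+2) k n + (M.+2 - v))%N.

(** Going up from [k M.+1 = 0]: if [k n.+1 = 0], interface [n] has no downward exit left, so its
    factor is nonzero only if [k n = 0]. *)
Lemma state_weight_end e k : k M.+1 = 0%N ->
  state_weight M.+2 e k = (\sum_(n < M.+2) k n == 0)%N%:R.
Proof.
move=> kM; rewrite /state_weight.
under eq_bigr => n _.
  have lt_n : (n.+1 < M.+2)%N by exact: (ltn_ord n).
  rewrite /last_exit lt_n [(M.+2 <= _)%N]leqNgt lt_n addn0.
  over.
case: eqP => [/eqP|k_neq0].
  rewrite sum_nat_eq0 => /forallP k0.
  have kE i : (i < M.+2)%N -> k i = 0%N by move=> h; exact/eqP/(k0 (Ordinal h)).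
  apply: big1 => n _; have lt_n : (n.+1 < M.+2)%N by exact: (ltn_ord n).
  by rewrite !kE ?exitsD_eq0 // ltnW.
apply/eqP; apply: contraT => prod_neq0; case: k_neq0; apply/eqP.
rewrite sum_nat_eq0; apply/forallP => n; rewrite -(subKn (ltn_ord n : (n <= M.+1)%N)) /=.
elim: (M.+1 - n)%N => [|i IHi]; first by rewrite subn0 kM.
have [le_iM|lt_Mi] := leqP i M; last first.
  by move: IHi; rewrite (_ : M.+1 - i = M.+1 - i.+1)%N //; lia.
rewrite subSS; move: IHi; rewrite (subSn le_iM) => /eqP kS.
move: prod_neq0 => /prodf_neq0/(_ (inord (M - i)) isT).
by rewrite inordK ?ltnS ?leq_subr // kS exitsD_eq0; case: (_ == 0)%N; rewrite ?eqxx.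
Qed.

(** The next exit is the first letter of the remaining word at interface [v.-1], and [exits_rec]
    splits on it; all other factors persist. *)
Lemma state_weight_rec v e k : (0 < v <= M.+1)%N ->
  state_weight v e k =
   (if (0 < k v.-1)%N then
      turn (r v.-1) (Tc r v.-1) e true * state_weight v.-1 false (decr k v.-1) else 0)
   + turn (r v.-1) (Tc r v.-1) e false * state_weight v.+1 true k.
Proof.
case: v => // j /= lt_jM.
pose f w e' k' n := exits (r n) (Tc r n) (last_exit w e' n.+1) (k' n) (k' n.+1 + (w <= n.+1))%N.
pose P w e' k' := \prod_(n < M.+1 | n != j :> nat) f w e' k' n.
have D1 w e' k' : state_weight w e' k' = f w e' k' j * P w e' k'.
  by rewrite /state_weight (bigD1 (Ordinal (lt_jM : (j < M.+1)%N))).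
rewrite !D1 {D1}.
have PP2 : P j.+1 e k = P j.+2 true k.
  apply: eq_bigr => i; move: (nat_of_ord i) => {}i ne_ij; rewrite /f /last_exit.
  congr exits; last by congr (_ + nat_of_bool _)%N; lia.
  rewrite implybT (_ : (i.+1 == j.+1) = false); last lia.
  by rewrite (_ : (i.+1 < j.+2) = (i.+1 < j.+1))%N; last lia.
(* At the interface just above, layer [j] has one upward crossing less to come but owes one more
   downward crossing: its count of downward exits is unchanged. *)
have PP1 : (0 < k j)%N -> P j.+1 e k = P j false (decr k j).
  move=> k_gt0; apply: eq_bigr => i; move: (nat_of_ord i) => {}i ne_ij.
  rewrite /f /last_exit /decr; congr exits; last first.
  - by case: (i.+1 =P j) => [->|ne]; lia.
  - by rewrite (negPf ne_ij) subn0.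
  rewrite (_ : (i.+1 == j.+1) = false); last lia.
  case: (i.+1 =P j) => [->|ne]; first by rewrite ltnn ltnSn.
  by rewrite (_ : (i.+1 < j.+1) = (i.+1 < j))%N; last lia.
(* The downward crossing owed below [v] supplies the successor that [exits_rec] requires. *)
rewrite -PP2 mulrA /f /last_exit !ltnSn !ltnn !eqxx /= addn0 addn1 exits_rec.
case: ifP => k_gt0; last by rewrite !add0r mulrA.
have jSj : (j.+1 == j) = false by apply: gtn_eqF.
by rewrite -PP1 // ltnNge leqnSn jSj /decr eqxx jSj subn0 subn1 addn1 mulrDl mulrA.
Qed.

(** Induction on [L]: [path_sumS] and [state_weight_rec] have the same shape, and [steps_left] drops
    by one in both branches. *)
Lemma path_sumE L u v (k : nat -> nat) : (0 < v <= M.+2)%N -> adjacent u v ->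
  k 0 = 0%N -> k M.+1 = 0%N ->
  path_sum L u v k = if L == steps_left v k then state_weight v (u < v)%N k else 0.
Proof.
elim: L u v k => [|L IHL] u v k /andP[v_gt0 v_le] adj_uv k0 kM.
  rewrite path_sum0 // /steps_left.
  have [->|ne_v] := eqVneq v M.+2.
    by rewrite subnn addn0 state_weight_end //; case: eqP => [->|] //=; case: eqP => //; lia.
  by rewrite ifF //=; apply/eqP; lia.
have [->|ne_v] := eqVneq v M.+2.
  rewrite path_sum_end state_weight_end // /steps_left subnn addn0.
  by case: eqP => //; case: eqP => // ->.
have vP : (0 < v <= M.+1)%N by lia.
rewrite path_sumS // state_weight_rec // (IHL v v.+1) //; [|lia|by rewrite /adjacent eqxx].
have wE w : (w = v.-1 \/ w = v.+1) ->
    vertex_weight u v w = turn (r v.-1) (Tc r v.-1) (u < v)%N (w < v)%N.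
  move=> wP; rewrite /vertex_weight /turn.
  have dirE x : (x = v.-1 \/ x = v.+1) -> (x == v.-1) = (x < v)%N /\ (x == v.+1) = ~~ (x < v)%N.
    by move=> h; split; lia.
  have [-> ->] := dirE _ wP; have [|-> ->] := dirE u.
    by move: adj_uv; rewrite /adjacent; lia.
  by case: (u < v)%N; case: (w < v)%N.
rewrite !wE; [|by right|by left].
rewrite (_ : (v.-1 < v)%N); last lia; rewrite (_ : (v.+1 < v)%N = false); last lia.
rewrite ltnSn /steps_left.
have [k_gt0|_] := ltnP 0 (k v.-1); last first.
  rewrite !add0r (_ : (L.+1 == _) = (L == 2 * \sum_(n < M.+2) k n + (M.+2 - v.+1)))%N; last lia.
  by case: eqP; rewrite ?mulr0.
(* [k 0 = 0] forbids a return to vertex 0, so the upper neighbour is again an interface. *)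
have v_gt1 : (1 < v)%N by rewrite ltnNge; apply/negP => v1; move: k_gt0; rewrite (_ : v.-1 = 0%N) ?k0 //; lia.
rewrite (IHL v v.-1); last 4 first.
- lia.
- by rewrite /adjacent prednK // eqxx orbT.
- by rewrite /decr k0.
- by rewrite /decr kM.
have lt_v : (v.-1 < M.+2)%N by lia.
(* One crossing less saves two steps, and the longer descent from [v.-1] costs one. *)
have sumk : (\sum_(n < M.+2) k n = (\sum_(n < M.+2) decr k v.-1 n).+1)%N.
  rewrite (bigD1 (Ordinal lt_v)) //= [in RHS](bigD1 (Ordinal lt_v)) //= /decr eqxx.
  rewrite -addSn; congr addn; first lia.
  by apply: eq_bigr => i; rewrite -val_eqE /= => /negPf ->; rewrite subn0.
rewrite /steps_left sumk.
rewrite (_ : (v < v.-1)%N = false); last lia.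
set s := (\sum_(n < M.+2) decr _ _ _)%N.
rewrite (_ : (L == 2 * s + _)%N = (L.+1 == 2 * s.+1 + (M.+2 - v)))%N; last lia.
rewrite (_ : (L == _) = (L.+1 == 2 * s.+1 + (M.+2 - v)))%N; last lia.
by case: eqP; rewrite ?mulr0 ?addr0.
Qed.

End PathSum.

(** * Scattering sequences with prescribed crossings *)

Lemma is_tssP M L (p : {ffun 'I_L.+1 -> 'I_M.+3}) :
  reflect [/\ pos p 0 = 0%N, pos p L = M.+2,
     forall i, (0 < i < L)%N -> (0 < pos p i <= M.+1)%N
   & forall i, (i < L)%N -> adjacent (pos p i) (pos p i.+1)] (is_tss p).
Proof.
apply: (iffP and4P) => [[/eqP p0 /eqP pL /forallP pint /forallP padj]|[-> -> pint padj]].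
  split=> // i iP; last exact: (padj (Ordinal iP)).
  by have := pint (inord i); rewrite inordK ?iP //; case/andP: iP => _; apply: ltnW.
by split=> //; apply/forallP => i; [apply/implyP => /pint | apply: padj].
Qed.

(** Without its initial vertex 0 such a sequence is a route from vertex 1, entered from above; the
    removed step is the outer successor. *)
Lemma sum_tss (R : realType) M (r : nat -> R) L (k : nat -> nat) :
  k 0 = 0%N -> k M.+1 = 0%N ->
  \sum_(p : {ffun 'I_L.+1 -> 'I_M.+3} |
       is_tss p && [forall n : 'I_M.+2, upcross L (pos p) n == k n]) weight r p =
  if L == (2 * \sum_(n < M.+2) k n + M.+1).+1 then state_weight M r 1 true k else 0.
Proof.
move=> k0 kM; case: L => [|L].
  by apply: big_pred0 => p; apply/negP => /andP[/is_tssP[-> //]].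
rewrite big_ffun_cons (bigD1 ord0) //= [X in _ + X]big1 ?addr0 => [|a ne_a0]; last first.
  apply: big_pred0 => q; apply/negP => /andP[/is_tssP[+ _ _ _]].
  by rewrite pos_ffun_cons0 => a0; rewrite -val_eqE /= a0 in ne_a0.
transitivity (path_sum M r L 0 1 k); last first.
  by rewrite path_sumE // /steps_left eqSS !subSS subn0.
have posS q := @pos_ffun_consS M L ord0 q; have pos0 q := @pos_ffun_cons0 M L ord0 q.
apply: eq_big => [q|q _].
  have upq n : upcross L.+1 (pos (ffun_cons ord0 q)) n = upcross L (pos q) n.
    by rewrite (upcrossS _ (posS q)) pos0.
  rewrite /route; under eq_forallb do rewrite upq.
  case: [forall n : 'I_M.+2, _]; rewrite ?andbF // !andbT.
  apply/is_tssP/and3P => [[_ pL pint padj]|[/eqP q0 /eqP qL /forallP qP]].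
    split; first by have := padj 0%N isT; rewrite pos0 posS // /adjacent orbF eq_sym.
      by rewrite -pL posS.
    apply/forallP => i; have := pint i.+1; have := padj i.+1.
    by rewrite !posS ?(ltnW (ltn_ord i)) // !ltnS (ltn_ord i) => /(_ isT) -> /(_ isT) ->.
  split; rewrite ?pos0 ?posS //.
    by case=> // i /andP[_ lt_iL]; case/andP: (qP (Ordinal (lt_iL : (i < L)%N))); rewrite posS // ltnW.
  case=> [_|i]; first by rewrite pos0 posS // q0.
  by rewrite ltnS => lt_iL; case/andP: (qP (Ordinal lt_iL)); rewrite !posS // ltnW.
(* The two end vertices carry no weight. *)
rewrite /weight big_mkcond big_ord_recl big_ord_recr /= /bump /= add1n ltnn mul1r mulr1.
apply: eq_bigr => -[[|i] lt_iL] _; rewrite /= !add1n ltnS lt_iL /= /vertex_weight.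
  by rewrite pos0 !posS.
by rewrite !posS ?(ltnW lt_iL) // ltnW // ltnW.
Qed.

(** At the start each interface counts as left upwards and owes one downward exit, which gives
    [exitsU (k n) (k n.+1 + 1)]; distributing the product over these sums yields the sum over
    [m]. *)
Lemma state_weight_bcoef (R : realType) M (r : nat -> R) (k : nat -> nat) :
  k M.+1 = 0%N -> state_weight M r 1 true k = bcoef M r k.
Proof.
move=> kM; rewrite /bcoef; set S := (\sum_(n < M.+1) k n)%N.
have ktE (n : 'I_M.+1) : ktilde M k n = k n.+1.
  rewrite /ktilde; case: ltnP => // le_Mn; rewrite -kM; congr (k _.+1).
  by apply/eqP; rewrite eqn_leq le_Mn -ltnS ltn_ord.
pose F (n : 'I_M.+1) m := ('C(k n, m) * 'C(ktilde M k n, m))%:R *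
  (- r n) ^+ (ktilde M k n - m) * r n ^+ (k n - m) * Tc r n ^+ (2 * m + 1).
transitivity (\prod_(n < M.+1) \sum_(m < S.+1 | (m <= minn (k n) (ktilde M k n))%N) F n m); last first.
  rewrite (bigA_distr_big_dep _ (fun n (m : 'I_S.+1) => F n m)); apply: eq_bigl => m.
  by apply/familyP/forallP => H n; have := H n.
apply: eq_bigr => n _; rewrite /last_exit ltnS ltn0 implybT /= addn1 /exitsU /=.
have F0 m : ((minn (k n) (ktilde M k n)).+1 <= m)%N -> F n m = 0.
  by rewrite ltnNge leq_min negb_and -!ltnNge => /orP[] /bin_small binE;
     rewrite /F binE ?muln0 ?mul0n !mul0r.
rewrite [RHS]big_mkcond (eq_bigr (fun m : 'I_S.+1 => F n m)) => [|m _]; last first.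
  by case: ifP => // /negbT; rewrite -ltnNge => /F0.
rewrite -ktE (@big_ord_trunc _ _ _ (F n) _ F0) ?ltnS ?geq_minr //.
rewrite (@big_ord_trunc _ _ S.+1 (F n) _ F0) // ltnS geq_min.
by rewrite /S (bigD1 n) //= leq_addr.
Qed.

Lemma kvecS M N (kk : {ffun 'I_M -> 'I_N}) (i : 'I_M) : kvec kk i.+1 = kk i.
Proof. by rewrite /kvec valK. Qed.

Lemma kvec_top M N (kk : {ffun 'I_M -> 'I_N}) : kvec kk M.+1 = 0%N.
Proof. by rewrite /kvec insubF ?ltnn. Qed.

(** * Arrival times and the bound on the number of steps *)

Section Medium.
Variables (R : realType) (M : nat) (tau : nat -> R).

Lemma arrivalE L (p : {ffun 'I_L.+1 -> 'I_M.+3}) : is_tss p ->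
  arrival tau p = tau_abs M tau / 2 + kdot M tau (upcross L (pos p)).
Proof.
case/is_tssP => p0 pL pint padj; rewrite /arrival (@travel_time _ tau M.+1) //.
  by rewrite pL p0 big_ord0 subr0 /tau_abs big_distrl.
by case=> [|i lt_iL]; [rewrite p0 | case/andP: (pint i.+1 lt_iL)].
Qed.

Lemma upcross_top L (p : {ffun 'I_L.+1 -> 'I_M.+3}) : is_tss p ->
  upcross L (pos p) M.+1 = 0%N.
Proof.
case/is_tssP => p0 pL pint padj; apply: big1 => -[[|i] /= lt_iL] _; first by rewrite p0.
by rewrite ltn_eqF //; case/andP: (pint i.+1 lt_iL).
Qed.

Lemma upcross_bot L (p : {ffun 'I_L.+1 -> 'I_M.+3}) : is_tss p ->
  upcross L (pos p) 0 = 0%N.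
Proof.
case/is_tssP => p0 pL pint padj; apply: big1 => -[i /= lt_iL] _.
have [lt_SiL|ge_SiL] := ltnP i.+1 L.
  by rewrite [pos p i.+1 == _]gtn_eqF ?andbF //; case/andP: (pint i.+1 lt_SiL).
by rewrite (_ : i.+1 = L) ?pL ?andbF //; apply/eqP; rewrite eqn_leq lt_iL.
Qed.

(** [inord] loses nothing when [L < N.+1], since a crossing count is at most [L]. *)
Definition crossing_vector N L (p : {ffun 'I_L.+1 -> 'I_M.+3}) : {ffun 'I_M -> 'I_N.+1} :=
  [ffun i : 'I_M => inord (upcross L (pos p) i.+1)].

Lemma kvec_crossing_vector N L (p : {ffun 'I_L.+1 -> 'I_M.+3}) n :
  (L < N.+1)%N -> is_tss p -> (n < M.+2)%N ->
  kvec (crossing_vector N p) n = upcross L (pos p) n.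
Proof.
move=> lt_LN tss_p; case: n => [|n] lt_nM; first by rewrite upcross_bot.
have [lt_n|le_Mn] := ltnP n M.
  rewrite (kvecS _ (Ordinal lt_n)) ffunE inordK //.
  exact: leq_ltn_trans (upcross_le _ _ _) lt_LN.
have -> : n = M by apply/eqP; rewrite eqn_leq le_Mn andbT -ltnS.
by rewrite kvec_top upcross_top.
Qed.

(** Layer [n] is crossed 2 k_n + 1 times. Weighting 2t < N tau_n by (2 k_n + 1)/2 and summing
    compares the number of steps times t with N t; then t > 0 cancels. *)
Lemma steps_bound N (t : R) (k : nat -> nat) :
  (forall j, (j <= M.+1)%N -> 0 < tau j) ->
  (forall j, (j <= M.+1)%N -> 2 * t < N%:R * tau j) ->
  k M.+1 = 0%N -> tau_abs M tau / 2 + kdot M tau k = t ->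
  ((2 * \sum_(n < M.+2) k n + M.+1).+1 < N)%N.
Proof.
move=> tau_gt0 tN kM tE.
have {}tE : t = \sum_(n < M.+2) ((2 * k n + 1)%:R / 2) * tau n.
  rewrite -tE /tau_abs /kdot big_distrl /=.
  have -> : \sum_(n < M.+1) (k n)%:R * tau n = \sum_(n < M.+2) (k n)%:R * tau n.
    by rewrite [RHS]big_ord_recr /= kM mul0r addr0.
  rewrite -big_split; apply: eq_bigr => n _ /=.
  by rewrite natrD natrM; field.
have t_gt0 : 0 < t.
  rewrite tE big_ord_recl; apply: ltr_wpDr.
    by apply: sumr_ge0 => n _; rewrite !mulr_ge0 ?invr_ge0 ?ler0n // ltW // tau_gt0 // -ltnS.
  by rewrite !mulr_gt0 ?invr_gt0 ?ltr0n ?addn1 // tau_gt0.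
have -> : (2 * \sum_(n < M.+2) k n + M.+1).+1 = (\sum_(n < M.+2) (2 * k n + 1))%N.
  by rewrite big_split /= -big_distrr /= sum_nat_const card_ord muln1 [RHS]addnS.
rewrite -(ltr_nat R) -(ltr_pM2r t_gt0) [X in _ < _ * X]tE big_distrr natr_sum big_distrl /=.
have term (n : 'I_M.+2) : (2 * k n + 1)%:R * t < N%:R * ((2 * k n + 1)%:R / 2 * tau n).
  rewrite (_ : _ * t = (2 * k n + 1)%:R / 2 * (2 * t)); last by field.
  rewrite [X in _ < X]mulrCA ltr_pM2l; first by rewrite tN // -ltnS.
  by rewrite mulr_gt0 ?invr_gt0 ?ltr0n ?addn1.
rewrite big_ord_recl [X in _ < X]big_ord_recl; apply: ltr_leD; first exact: term.
by apply: ler_sum => n _; apply: ltW; apply: term.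
Qed.

End Medium.

Theorem theorem2 (R : realType) (M : nat) (tau r : nat -> R) :
  (1 <= M)%N ->
  (forall j, (j <= M.+1)%N -> 0 < tau j) ->
  (forall n, (n <= M)%N -> -1 < r n < 1) ->
  forall (t : R) (N : nat),
    (forall j, (j <= M.+1)%N -> 2 * t < N%:R * tau j) ->
    Hcoef M tau r N t = RHScoef M tau r N t.
Proof.
move=> M_gt0 tau_gt0 _ t [|N] tN.
  (* As [M] is positive, [kk] would need a value in the empty type ['I_0]. *)
  by rewrite /Hcoef big_ord0 /RHScoef big1 // => kk _; case: (kk (Ordinal M_gt0)).
pose Q (kk : {ffun 'I_M -> 'I_N.+1}) := tau_abs M tau / 2 + kdot M tau (kvec kk) == t.
have dotE L (p : {ffun 'I_L.+1 -> 'I_M.+3}) : (L < N.+1)%N -> is_tss p ->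
    arrival tau p = tau_abs M tau / 2 + kdot M tau (kvec (crossing_vector N p)).
  move=> lt_LN tss_p; rewrite arrivalE //; congr (_ + _); apply: eq_bigr => n _.
  by rewrite kvec_crossing_vector // ltnS ltnW.
transitivity (\sum_(L < N.+1) \sum_(kk | Q kk)
   \sum_(p : {ffun 'I_L.+1 -> 'I_M.+3} |
       is_tss p && [forall n : 'I_M.+2, upcross L (pos p) n == kvec kk n]) weight r p).
  (* The arrival time depends only on the crossing vector, so grouping by that vector is compatible
     with fixing [t]. *)
  apply: eq_bigr => L _; rewrite (partition_big (@crossing_vector M N L) Q) /=; last first.
    by move=> p /andP[tss_p]; rewrite dotE.
  apply: eq_bigr => kk Qkk; apply: eq_bigl => p; rewrite -andbA.
  case tss_p: (is_tss p) => //=; rewrite (dotE L) //.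
  apply/andP/forallP => [[_ /eqP <-] n|up_k]; first by rewrite kvec_crossing_vector.
  suff <- : kk = crossing_vector N p by [].
  apply/ffunP => i; have lt_i : (i.+1 < M.+2)%N by rewrite !ltnS ltnW.
  apply/val_inj; rewrite /= -!kvecS kvec_crossing_vector //.
  by apply/esym/eqP; apply: (up_k (Ordinal lt_i)).
rewrite exchange_big; apply: eq_bigr => kk /eqP Qkk /=.
rewrite -state_weight_bcoef ?kvec_top //.
under eq_bigr do rewrite sum_tss ?kvec_top //.
(* The crossings determine the length, and the bound places it in the summation range: exactly one
   [L] contributes. *)
have lt_steps := steps_bound tau_gt0 tN (kvec_top kk) Qkk.
rewrite (bigD1 (Ordinal lt_steps)) //= eqxx big1 ?addr0 // => L.
by rewrite -val_eqE /= => /negPf ->.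
Qed.
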